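(* Let $\mathbb{F}$ be a field of characteristic different from $2$, let $V$ be a finite-dimensional vector space over $\mathbb{F}$, and let $b$ be a symplectic form on $V$. Let $u \in \mathrm{Sp}(b)$. The following conditions are equivalent: (i) $u$ is the product of two $U_2$-elements of $\mathrm{GL}(V)$; (ii) $u$ is the product of two $U_2$-elements of $\mathrm{Sp}(b)$; (iii) $u$ has no Jordan cell of odd size for the eigenvalue $-1$.
   Context: A symplectic form is a non-degenerate bilinear form $b$ with $b(y,x)=-b(x,y)$ for all $x,y$. $\mathrm{Sp}(b)$ is the group of all automorphisms $u$ of $V$ with $b(u(x),u(y))=b(x,y)$ for all $x,y \in V$. An automorphism $u$ of $V$ is a $U_2$-element (unipotent of index $2$) when $(u-\mathrm{id}_V)^2=0$ (in particular the identity is a $U_2$-element). A $U_2$-element of a subgroup $G\subseteq \mathrm{GL}(V)$ is an element of $G$ that is a $U_2$-element of $\mathrm{GL}(V)$. *)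

(* Defs.v *)
From mathcomp Require Import all_boot all_order all_algebra.

Set Implicit Arguments.
Unset Strict Implicit.
Unset Printing Implicit Defensive.

Import GRing.Theory.
Local Open Scope ring_scope.

Section Unipotent2.

Variables (F : fieldType) (V : vectType F).
Implicit Types u : 'End(V).

(* V is finite-dimensional, so an endomorphism is an automorphism as soon as
   it is injective. *)
Definition in_GL u : Prop := lker u = 0%VS.

Definition in_Sp (b : {skew_symmetric V}) u : Prop := in_GL u /\ isometry b b u.

Definition is_U2 u : Prop := in_GL u /\ ((u - \1) \o (u - \1))%VF = 0.

Definition prod_two_U2 (G : 'End(V) -> Prop) u : Prop :=
  exists u1 u2 : 'End(V),
    [/\ G u1, is_U2 u1, G u2, is_U2 u2 & u = (u1 \o u2)%VF].

(* Eigenvalue a on the diagonal, ones just above it. *)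
Definition jordan_block (k : nat) (a : F) : 'M[F]_k :=
  \matrix_(i, j) (a *+ (i == j) + (i.+1 == j :> nat)%:R).

(* The size-k Jordan block for a occurs as a diagonal block in some
   block-diagonal matrix of u: V splits as W + W' with both summands stable
   under u, and u acts on a basis e of W through that block (the j-th column
   holds the coordinates of u e_j).  Size 0 is excluded, as it would always
   occur. *)
Definition has_jordan_cell u (k : nat) (a : F) : Prop :=
  (0 < k)%N /\
  exists (W W' : {vspace V}) (e : k.-tuple V),
    [/\ directv (W + W') /\ (W + W')%VS = fullv,
        (u @: W <= W)%VS,
        (u @: W' <= W')%VS,
        basis_of W e
      & forall j : 'I_k,
          u (tnth e j) = \sum_(i < k) jordan_block k a i j *: tnth e i].

End Unipotent2.

(* Main.v *)
From HB Require Import structures.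
Require Import Defs.
From mathcomp Require Import all_boot all_order all_algebra.
From mathcomp Require Import ring zify.
From Stdlib Require Import Classical.

Set Implicit Arguments.
Unset Strict Implicit.
Unset Printing Implicit Defensive.

Import GRing.Theory.
Local Open Scope ring_scope.

(** Write [shift = u - 1], [coshift = 1 - u^-1] and
    [quad = shift coshift = u + u^-1 - 2].  The last one is self-adjoint for [b],
    so each cyclic [F[quad]]-module [L] is totally isotropic:
    [b(x, f(quad) x) = - b(f(quad) x, x) = - b(x, f(quad) x)].

    (i) implies (iii).  If [u = (1 + a)(1 + c)] with [a^2 = c^2 = 0], then
    [u + u^-1 + 2 = ac + ca + 4] commutes with [a] and [c], while
    [(u + 1)^2 = u (u + u^-1 + 2)]; hence [c] maps the image of [(u + 1)^(2m)]
    into itself.  If [(u + 1) y = 0], then [2 y = (a - c) y] and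
    [(u + 1)(c y) = - 4 y].  So a vector of the image of [(u + 1)^(2m)] killed
    by [u + 1] also lies in the image of [(u + 1)^(2m+1)]
    ([plus1_kernel_image]), and a Jordan cell of size [2m+1] for [-1] would
    contain a vector that violates this ([jordan_cell_vector]).

    (iii) implies (ii).  Let [V = P + Q] with [P] and [Q] totally isotropic,
    [shift P <= Q] and [coshift Q <= P].  Then [u = u1 u2], where [u1] is [u] on
    [P] and the identity on [Q], while [u2] is the identity on [P] and
    [1 + coshift] on [Q]; both are unipotent of index 2, and they are isometries
    because [P] and [Q] are isotropic ([adapted_prod_two_U2]).

    Such a pair is built up from pairs whose sum [P + Q] is only nondegenerate,
    by adding pieces inside the orthogonal complement [U] of [P + Q].  Choose an
    irreducible [r], an exponent [n] and [m] prime to [r] such that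
    [r^(n+1) m] annihilates [quad] on [U] and [r^n m] does not; the vectors below
    are taken in the [r]-primary part [m(quad) U].
    - If [(u - u^-1) r^n m (quad)] is not zero on [U], polarization gives [x] and
      [h] with [b(r^n h (quad) x, u x) <> 0].  This says that the pairing of
      [L = F[quad] x] with [shift L] is perfect, and [(L, shift L)] is a new
      piece ([adapted_cyclic]).
    - Otherwise [(u - u^-1)^2 = quad (quad + 4)] forces [r] to be [X] or [X + 4].
    - If [r = X], then [shift quad^n] kills [m(quad) U].  Choose [x] there with
      [quad^n x <> 0], and then [y] there with [b(quad^n x, y) <> 0] and [y]
      orthogonal to [shift F[quad] x].  The pair made of
      [F[quad] x + coshift F[quad] y] and [F[quad] y + shift F[quad] x]
      is a new piece ([adapted_hyperbolic]).
    - If [r = X + 4], then [(u + 1)^(2n) x] is, for a suitable [x], killed by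
      [u + 1] but not in the image of [(u + 1)^(2n+1)], so that [u] has a Jordan
      cell of the odd size [2n+1] for [-1] ([odd_cell_minus1]).
    Under (iii) the last case is excluded, and the process stops at
    [P + Q = V]. *)

(** * Polynomials in an endomorphism *)
Section PolynomialAction.

Variables (F : fieldType) (V : vectType F).
Implicit Types (g h : 'End(V)) (p q : {poly F}) (U : {vspace V}).

(** [pact g p] is [p(g)], as an endomorphism.  The space may be zero, so its
    endomorphisms need not form a nontrivial ring, whence a plain sum of powers. *)
Definition pact g p : 'End(V) :=
  \sum_(i < size p) p`_i *: iter i (comp_lfun g) \1%VF.

Lemma pact_wide n g p v : (size p <= n)%N ->
  pact g p v = \sum_(i < n) p`_i *: iter i g v.
Proof.
move=> le_pn; have iterE i : iter i (comp_lfun g) \1%VF v = iter i g v.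
  by elim: i => [|i IHi] /=; rewrite lfunE //= IHi.
rewrite /pact sum_lfunE.
under eq_bigr do rewrite scale_lfunE iterE.
rewrite (big_ord_widen _ (fun i => p`_i *: iter i g v) le_pn) big_mkcond.
apply: eq_bigr => i _ /=.
by case: ltnP => // le_pi; rewrite nth_default ?scale0r.
Qed.

Lemma pactE g p v : pact g p v = \sum_(i < size p) p`_i *: iter i g v.
Proof. exact: pact_wide. Qed.

Lemma pactD g p q v : pact g (p + q) v = pact g p v + pact g q v.
Proof.
pose n := maxn (size p) (size q).
rewrite (@pact_wide n) ?size_polyD // (@pact_wide n) ?leq_maxl //.
rewrite (@pact_wide n) ?leq_maxr // -big_split /=.
by apply: eq_bigr => i _; rewrite coefD scalerDl.
Qed.

Lemma pactZ g c p v : pact g (c *: p) v = c *: pact g p v.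
Proof.
rewrite (@pact_wide (size p)) ?size_scale_leq // pactE scaler_sumr.
by apply: eq_bigr => i _; rewrite coefZ scalerA.
Qed.

Lemma pactC g c v : pact g c%:P v = c *: v.
Proof.
by rewrite (@pact_wide 1) ?size_polyC_leq1 // big_ord1 coefC.
Qed.

Lemma pactN g p v : pact g (- p) v = - pact g p v.
Proof. by rewrite -scaleN1r pactZ scaleN1r. Qed.

Lemma pactB g p q v : pact g (p - q) v = pact g p v - pact g q v.
Proof. by rewrite pactD pactN. Qed.

Lemma pactMX g p v : pact g (p * 'X) v = pact g p (g v).
Proof.
have le_pX: (size (p * 'X)%R <= (size p).+1)%N.
  by rewrite (leq_trans (size_polyMleq _ _)) // size_polyX addn2.
rewrite (pact_wide _ _ le_pX) pactE big_ord_recl coefMX scale0r add0r.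
by apply: eq_bigr => i _; rewrite coefMX /= -iterSr.
Qed.

Lemma pactM g p q v : pact g (p * q) v = pact g p (pact g q v).
Proof.
elim/poly_ind: q v => [|q c IHq] v.
  by rewrite mulr0 -(scale0r 0) !pactZ !scale0r linear0.
rewrite mulrDr mulrA pactD pactMX [p * _%:P]mulrC mul_polyC pactZ.
by rewrite pactD pactMX pactC linearD linearZ /= IHq.
Qed.

Lemma pactMC g p q v : pact g p (pact g q v) = pact g q (pact g p v).
Proof. by rewrite -!pactM mulrC. Qed.

Lemma pactX g v : pact g 'X v = g v.
Proof. by rewrite -(mul1r 'X) pactMX pactC scale1r. Qed.

Lemma pact1 g v : pact g 1 v = v.
Proof. by rewrite pactC scale1r. Qed.

Lemma pactXn g i v : pact g 'X^i v = iter i g v.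
Proof.
elim: i v => [|i IHi] v; first by rewrite expr0 pact1.
by rewrite exprSr pactMX IHi -iterSr.
Qed.

Lemma pact_comm g h p : (forall v, g (h v) = h (g v)) ->
  forall v, pact g p (h v) = h (pact g p v).
Proof.
move=> gh v; rewrite !pactE linear_sum; apply: eq_bigr => i _.
rewrite linearZ; congr (_ *: _).
by elim: (nat_of_ord i) => //= k ->.
Qed.

Lemma pact_stable g p U :
  {in U, forall v, g v \in U} -> {in U, forall v, pact g p v \in U}.
Proof.
move=> gU v Uv; rewrite pactE rpred_sum // => i _; rewrite rpredZ //.
by elim: (nat_of_ord i) => //= k; apply: gU.
Qed.

(** The powers of [g] of exponent at most the dimension of the endomorphism space
    are linearly dependent.  The bound on the size lets [cyclic] be the image of a
    fixed finite-dimensional space of polynomials. *)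
Lemma pact_annihilator g :
  exists p, [/\ p != 0, (size p <= (\dim {:'End(V)}).+1)%N
    & forall v, pact g p v = 0].
Proof.
pose n := (\dim {:'End(V)}).+1.
pose T (r : 'rV[F]_n) : 'End(V) := pact g (rVpoly r).
have Tlin : linear T.
  move=> c r s; apply/lfunP=> v.
  by rewrite add_lfunE scale_lfunE /T linearP /= pactD pactZ.
pose Tm := GRing.isLinear.Build _ _ _ _ T Tlin.
pose TL : {linear 'rV[F]_n -> 'End(V)} := HB.pack T Tm.
have: (lker (linfun TL) != 0)%VS.
  rewrite -dimv_eq0 -lt0n; have := limg_ker_dim (linfun TL) fullv.
  rewrite capfv dimvf.
  have -> : dim 'rV[F]_n = n by rewrite /dim /= mul1n.
  move=> dimE; have := dimvS (subvf (limg (linfun TL))).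
  rewrite -ltnS -/n => lt_img; rewrite lt0n; apply: contraTneq lt_img => ker0.
  by rewrite -leqNgt; move/esym/eq_leq: dimE; rewrite ker0.
rewrite -vpick0; set r := vpick _ => r_neq0.
have /eqP Tr0: linfun TL r == 0 by rewrite -memv_ker memv_pick.
exists (rVpoly r); split; [|exact: size_poly|].
  by apply: contra r_neq0 => /eqP pr0; rewrite -[r]rVpolyK pr0 linear0.
by move=> v; move: Tr0; rewrite lfunE /= /T => ->; rewrite zero_lfunE.
Qed.

End PolynomialAction.

(** * Primary parts *)
Section PolynomialFactors.

Variable F : fieldType.
Implicit Types (p q r : {poly F}).

Lemma monic_irreducible_factor p : (1 < size p)%N ->
  exists r, [/\ r \is monic, irreducible_poly r & r %| p].
Proof.
elim/ltn_ind: (size p) {-2}p (erefl (size p)) => n IHn {}p pn.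
rewrite pn => n_gt1.
have p_neq0 : p != 0 by rewrite -size_poly_gt0 pn ltnW.
have [[d [d_gt1 d_ltn d_dvd]]|no_d] :=
  classic (exists d : {poly F}, [/\ (1 < size d)%N, (size d < n)%N & d %| p]).
  have [r [r_monic r_irr r_dvd]] := IHn _ d_ltn d erefl d_gt1.
  by exists r; split=> //; apply: dvdp_trans d_dvd.
have c_neq0 : (lead_coef p)^-1 != 0 by rewrite invr_eq0 lead_coef_eq0.
exists ((lead_coef p)^-1 *: p); split; last by rewrite dvdpZl.
  by rewrite monicE lead_coefZ mulVf // lead_coef_eq0.
split=> [|d d_neq1]; first by rewrite size_scale // pn.
rewrite dvdpZr // => d_dvd; rewrite (eqp_rtrans (eqp_scale p c_neq0)).
rewrite -dvdp_size_eqp // pn eqn_leq -{1}pn dvdp_leq //= leqNgt.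
apply/negP=> d_ltn; apply: no_d; exists d; split=> //.
rewrite ltn_neqAle eq_sym d_neq1 size_poly_gt0 /=.
by apply: contraTneq d_dvd => ->; rewrite dvd0p.
Qed.

Lemma factor_out r p : (1 < size r)%N -> p != 0 ->
  exists n q, p = r ^+ n * q /\ ~~ (r %| q).
Proof.
move=> r_gt1.
elim/ltn_ind: (size p) {-2}p (erefl (size p)) => n IHn {}p pn p_neq0.
have [/dvdpP[q Dp]|r_ndvd] := boolP (r %| p); last first.
  by exists 0, p; rewrite expr0 mul1r.
have q_neq0 : q != 0 by apply: contraNneq p_neq0 => q0; rewrite Dp q0 mul0r.
have r_neq0 : r != 0 by rewrite -size_poly_gt0 (leq_trans _ r_gt1).
have q_lt : (size q < n)%N.
  rewrite -pn Dp size_mul // -subn1 -addnBA ?(leq_trans _ r_gt1) //.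
  by rewrite -[X in (X < _)%N]addn0 ltn_add2l subn_gt0.
have [k [s [Dq r_ndvd]]] := IHn _ q_lt q erefl q_neq0.
by exists k.+1, s; split=> //; rewrite Dp Dq exprS; ring.
Qed.

Lemma bezout_irreducible r p : irreducible_poly r -> ~~ (r %| p) ->
  exists c d, c * p + d * r = 1.
Proof.
move=> r_irr; rewrite -irreducible_poly_coprime // => /Bezout_eq1_coprimepP.
by case=> -[d c] /= <-; exists c, d; rewrite addrC.
Qed.

(** In the local ring [F[X] / r^(n+1)] every nonzero element has a multiple equal
    to [r^n], because up to a unit it is a power of [r]. *)
Lemma socle_multiple r n f : irreducible_poly r -> ~~ (r ^+ n.+1 %| f) ->
  exists g c, g * f = r ^+ n + c * r ^+ n.+1.
Proof.
move=> r_irr r_ndvd.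
have f_neq0 : f != 0 by apply: contraNneq r_ndvd => ->; rewrite dvdp0.
have [i [f' [Df /(bezout_irreducible r_irr)[c [d cd1]]]]] :=
  factor_out r_irr.1 f_neq0.
have le_in : (i <= n)%N.
  rewrite leqNgt; apply: contra r_ndvd => lt_ni.
  by rewrite Df dvdp_mulr // dvdp_exp2l.
exists (r ^+ (n - i) * c), (- d).
rewrite Df -{2 3}(subnK le_in) -addSn !exprD exprS.
transitivity (r ^+ (n - i) * r ^+ i * (c * f')); first by ring.
by rewrite (_ : c * f' = 1 - d * r); [ring | rewrite -cd1 addrK].
Qed.

End PolynomialFactors.

Section PrimaryVectors.

Variables (F : fieldType) (V : vectType F) (g : 'End(V)).
Implicit Types (p q r : {poly F}) (x v : V) (U : {vspace V}).

Local Notation "p ** v" := (pact g p v) (at level 40).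

Lemma pact_dvd p q v : p %| q -> p ** v = 0 -> q ** v = 0.
Proof. by case/dvdpP=> s -> pv0; rewrite pactM pv0 linear0. Qed.

Lemma pact_coprime p q c d v :
  c * p + d * q = 1 -> p ** v = 0 -> q ** v = 0 -> v = 0.
Proof.
move=> cd1 pv0 qv0; rewrite -[v](pact1 g) -cd1 pactD !pactM pv0 qv0.
by rewrite !linear0 addr0.
Qed.

(** Start from any annihilating polynomial and divide it by irreducible factors
    as long as the quotient still annihilates [U]. *)
Lemma primary_component U : U != 0%VS -> {in U, forall v, g v \in U} ->
  exists r n m, [/\ r \is monic, irreducible_poly r, ~~ (r %| m),
    {in U, forall v, (r ^+ n.+1 * m) ** v = 0} &
    exists2 x, x \in U & (r ^+ n * m) ** x != 0].
Proof.
move=> U_neq0 gU; have [p [p_neq0 _ p_ann]] := pact_annihilator g.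
have {p_ann}: {in U, forall v, p ** v = 0} by move=> v _; apply: p_ann.
elim/ltn_ind: (size p) {-2}p (erefl (size p)) p_neq0 => k IHk {}p pk p_neq0 pU.
have p_gt1 : (1 < size p)%N.
  rewrite ltn_neqAle eq_sym size_poly_gt0 p_neq0 andbT.
  apply: contraNneq U_neq0 => /eqP/size_poly1P[c c_neq0 Dp].
  rewrite -vpick0; have := pU _ (memv_pick U).
  by rewrite Dp pactC => /eqP; rewrite scaler_eq0 (negPf c_neq0).
have [r [r_monic r_irr r_dvd]] := monic_irreducible_factor p_gt1.
have [[|n] [m [Dp r_ndvd]]] := factor_out r_irr.1 p_neq0.
  by rewrite Dp expr0 mul1r (negPf r_ndvd) in r_dvd.
have [|] := boolP [forall i : 'I_(\dim U), (r ^+ n * m) ** (vbasis U)`_i == 0].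
  move=> /forallP s0; pose s := r ^+ n * m.
  have sU : {in U, forall v, s ** v = 0}.
    move=> v Uv; rewrite (coord_vbasis Uv) linear_sum big1 // => i _.
    by rewrite linearZ /= (eqP (s0 i)) scaler0.
  have Dps : p = r * s by rewrite Dp exprS mulrA.
  have s_neq0 : s != 0.
    by apply: contraNneq p_neq0 => s_eq0; rewrite Dps s_eq0 mulr0.
  apply: (IHk (size s) _ s erefl s_neq0 sU).
  rewrite -pk Dps (size_mul (irredp_neq0 r_irr) s_neq0).
  case: r_irr => + _; case: (size r) => [|[|k']] // _.
  by rewrite !addSn /= ltnS leq_addl.
rewrite negb_forall => /existsP[i xi_neq0].
exists r, n, m; split=> //; first by rewrite -Dp.
by exists (vbasis U)`_i => //; rewrite vbasis_mem // mem_nth // size_tuple.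
Qed.

Section PrimaryVector.

Variables (r : {poly F}) (n : nat) (x : V).
Hypotheses (r_irr : irreducible_poly r).
Hypotheses (rx0 : r ^+ n.+1 ** x = 0) (rx_neq0 : r ^+ n ** x != 0).

(** The cyclic module generated by [x] is [F[X] / r^(n+1)], where every nonzero
    submodule contains the one generated by [r^n]; so a linear form that does not
    vanish on the latter has no nonzero submodule in its kernel. *)
Lemma pact_socle f : f ** x != 0 -> exists h, (h * f) ** x = r ^+ n ** x.
Proof.
move=> fx_neq0; have r_ndvd : ~~ (r ^+ n.+1 %| f).
  by apply: contra fx_neq0 => /pact_dvd->.
have [h [c Dhf]] := socle_multiple r_irr r_ndvd.
by exists h; rewrite Dhf pactD pactM rx0 linear0 addr0.
Qed.

Lemma pact_eq0_dvd f : f ** x = 0 -> r ^+ n.+1 %| f.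
Proof.
move=> fx0; apply: contraNT rx_neq0 => r_ndvd.
have [h [c Dhf]] := socle_multiple r_irr r_ndvd.
have: (h * f) ** x = 0 by rewrite pactM fx0 linear0.
by rewrite Dhf pactD pactM rx0 linear0 addr0 => ->.
Qed.

End PrimaryVector.

Let N := (\dim {:'End(V)}).+1.

Let orbit_map x (c : 'rV[F]_N) : V := rVpoly c ** x.

Fact orbit_map_linear x : linear (orbit_map x).
Proof. by move=> a c d; rewrite /orbit_map linearP /= pactD pactZ. Qed.

HB.instance Definition _ x :=
  GRing.isLinear.Build F 'rV[F]_N V _ (orbit_map x) (orbit_map_linear x).

Definition cyclic x : {vspace V} := limg (linfun (orbit_map x)).

Lemma cyclicP x v : reflect (exists f, v = f ** x) (v \in cyclic x).
Proof.
apply: (iffP memv_imgP) => [[c _ ->]|[f ->]].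
  by exists (rVpoly c); rewrite lfunE.
have [p [p_neq0 p_size p_ann]] := pact_annihilator g.
exists (poly_rV (f %% p)); rewrite ?memvf // lfunE /= /orbit_map poly_rV_K.
  by rewrite {1}(divp_eq f p) pactD pactM p_ann linear0 add0r.
by apply: leq_trans p_size; rewrite ltnW // ltn_modp.
Qed.

End PrimaryVectors.

(** * Orthogonality for a nondegenerate alternating form *)
Section SymplecticIsometry.

Variables (F : fieldType) (V : vectType F) (b : {skew_symmetric V}).
Hypothesis two_neq0 : 2%:R != 0 :> F.
Hypothesis b_nondeg : nondegenerate b.
Implicit Types (x y z : V) (D E P Q U : {vspace V}).

(* Rewriting with the generic bilinearity lemmas exposes the bilinear structure
   underlying [b] and blocks later rewriting steps; these keep [b] folded. *)
Lemma formDl x y z : b (x + y) z = b x z + b y z. Proof. exact: linearDl. Qed.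
Lemma formDr x y z : b x (y + z) = b x y + b x z. Proof. exact: linearDr. Qed.
Lemma formBl x y z : b (x - y) z = b x z - b y z. Proof. exact: linearBl. Qed.
Lemma formBr x y z : b x (y - z) = b x y - b x z. Proof. exact: linearBr. Qed.
Lemma formZl c x y : b (c *: x) y = c * b x y. Proof. exact: linearZl. Qed.
Lemma formZr c x y : b x (c *: y) = c * b x y. Proof. exact: linearZ. Qed.
Lemma form0r x : b x 0 = 0. Proof. exact: linear0r. Qed.

Lemma skewC x y : b x y = - b y x.
Proof. by rewrite hermC expr1 mulN1r. Qed.

Definition nondeg_on E :=
  {in E, forall x, {in E, forall y, b x y = 0} -> x = 0}.

Definition isotropic P := {in P &, forall x y, b x y = 0}.

Lemma nondeg_full : nondeg_on fullv.
Proof.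
move=> x _ xV0; apply/eqP; rewrite -memv0 -(eqP b_nondeg).
exact/mem_orthovP.
Qed.

Lemma separating_form D z : z \notin D ->
  exists2 l : 'Hom(V, F^o), {in D, forall x, l x = 0} & l z != 0.
Proof.
move=> D'z; pose w := z - projv D z.
have w_neq0 : w != 0.
  apply: contraNneq D'z => /eqP; rewrite subr_eq0 => /eqP->.
  exact: memv_proj.
have [i wi_neq0] : exists i, coord (vbasis fullv) i w != 0.
  apply/existsP; apply: contraNT w_neq0; rewrite negb_exists => /forallP w0.
  rewrite (coord_vbasis (memvf w)) big1 // => i _.
  by rewrite (eqP (negPn (w0 i))) scale0r.
exists (linfun (coord (vbasis fullv) i : V -> F^o) \o (\1 - projv D))%VF.
  move=> x Dx; rewrite comp_lfunE add_lfunE opp_lfunE id_lfunE projv_id //.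
  by rewrite subrr linear0.
by rewrite comp_lfunE lfunE add_lfunE opp_lfunE id_lfunE.
Qed.

Definition skew_form x : 'Hom(V, F^o) := linfun (b x : V -> F^o).

Lemma skew_formE x y : skew_form x y = b x y.
Proof. by rewrite lfunE. Qed.

Fact skew_form_map_linear : linear skew_form.
Proof.
move=> c x y; apply/lfunP=> z; rewrite add_lfunE scale_lfunE !skew_formE.
by rewrite formDl formZl.
Qed.

HB.instance Definition _ :=
  GRing.isLinear.Build F V 'Hom(V, F^o) _ skew_form skew_form_map_linear.

Lemma riesz (l : 'Hom(V, F^o)) : exists w, forall x, l x = b w x.
Proof.
have skew_inj : lker (linfun skew_form) = 0%VS.
  apply/eqP; rewrite -subv0; apply/subvP=> x; rewrite memv_ker lfunE /= memv0.
  move/eqP=> x0; apply/eqP/nondeg_full; rewrite ?memvf // => y _.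
  by rewrite -skew_formE x0 zero_lfunE.
have: l \in limg (linfun skew_form).
  have -> : limg (linfun skew_form) = fullv; last exact: memvf.
  apply/eqP; rewrite eqEdim subvf limg_dim_eq ?capfv //.
  by rewrite !dimvf /dim /= muln1.
by case/memv_imgP=> w _ ->; exists w => x; rewrite lfunE skew_formE.
Qed.

Lemma orthov_separation D z : z \notin D ->
  exists2 w, {in D, forall x, b x w = 0} & b z w != 0.
Proof.
case/separating_form=> l lD lz; have [w lE] := riesz l; exists w.
  by move=> x Dx; rewrite skewC -lE lD ?oppr0.
by rewrite skewC oppr_eq0 -lE.
Qed.

(** If the sum were proper, a nonzero [w] would be orthogonal to both summands.
    Orthogonality to the second one puts [w] in [E], as [E] is its own double
    orthogonal, and then nondegeneracy of [E] kills it. *)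
Lemma orthov_split E : nondeg_on E -> (E + orthov b E)%VS = fullv.
Proof.
move=> E_nondeg; apply/eqP; rewrite eqEsubv subvf; apply/subvP=> z _.
apply: contraT => /orthov_separation[w wE bzw]; case/eqP: bzw.
have Ew : w \in E.
  apply: contraT => /orthov_separation[y yE bwy]; case/eqP: bwy.
  rewrite skewC wE ?oppr0 // (subvP (addvSr _ _)) //; apply/mem_orthovP=> x Ex.
  by rewrite skewC yE ?oppr0.
have -> : w = 0.
  apply: E_nondeg => // x Ex; rewrite skewC wE ?oppr0 //.
  by rewrite (subvP (addvSl _ _)).
by rewrite form0r.
Qed.

Lemma orthov_decomp E x : nondeg_on E ->
  exists y z, [/\ x = y + z, y \in E & z \in orthov b E].
Proof.
move/orthov_split=> EV; have: x \in (E + orthov b E)%VS by rewrite EV memvf.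
by case/memv_addP=> y Ey [z E'z ->]; exists y, z.
Qed.

Lemma nondeg_orthov E : nondeg_on E -> nondeg_on (orthov b E).
Proof.
move=> E_nondeg x E'x x0; apply: nondeg_full; rewrite ?memvf // => y _.
have [e [z [-> Ee E'z]]] := orthov_decomp y E_nondeg.
by rewrite formDr (x0 z) // (mem_orthovP E'x) // addr0.
Qed.

Lemma nondeg_add E U : nondeg_on E -> nondeg_on U -> (U <= orthov b E)%VS ->
  nondeg_on (E + U).
Proof.
move=> En Un /orthovP UE _ /memv_addP[x Ex [y Uy ->]] xy0.
suffices [-> ->] : x = 0 /\ y = 0 by rewrite addr0.
split.
  apply: En => // e Ee; have := xy0 e (subvP (addvSl _ _) _ Ee).
  by rewrite formDl (UE y) // addr0.
apply: Un => // e Ue; have := xy0 e (subvP (addvSr _ _) _ Ue).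
by rewrite formDl skewC (UE e) // oppr0 add0r.
Qed.

Lemma isotropic_add P Q : isotropic P -> isotropic Q ->
  {in P & Q, forall x y, b x y = 0} -> isotropic (P + Q).
Proof.
move=> Piso Qiso PQ0 _ t /memv_addP[x Px [y Qy ->]].
case/memv_addP=> x' Px' [y' Qy' ->].
rewrite formDl !formDr (skewC y) (Piso x) // (Qiso y) // !PQ0 //.
by rewrite oppr0 !addr0.
Qed.

Lemma nondeg_witness U x : nondeg_on U -> x \in U -> x != 0 ->
  exists2 w, w \in U & b x w != 0.
Proof.
move=> U_nondeg Ux x_neq0; apply/mem_orthovPn.
by apply: contra x_neq0 => /mem_orthovP xU0; apply/eqP/U_nondeg.
Qed.

End SymplecticIsometry.

(** * Symplectic isometries and adapted pairs *)
Section Isometry.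

Variables (F : fieldType) (V : vectType F) (b : {skew_symmetric V}).
Hypothesis two_neq0 : 2%:R != 0 :> F.
Hypothesis b_nondeg : nondegenerate b.
Variable u : 'End(V).
Hypothesis u_Sp : in_Sp b u.
Implicit Types (x y z : V) (D E P Q U : {vspace V}).

Local Notation v := (u^-1)%VF.

Lemma Sp_invK : cancel v u.
Proof. by apply: lker0_lfunVK; apply/eqP; case: u_Sp. Qed.

Lemma Sp_invKl : cancel u v.
Proof. by apply: lker0_lfunK; apply/eqP; case: u_Sp. Qed.

Lemma Sp_form x y : b (u x) (u y) = b x y.
Proof. by case: u_Sp. Qed.

Lemma Sp_adjl x y : b (u x) y = b x (v y).
Proof. by rewrite -{1}[y]Sp_invK Sp_form. Qed.

Lemma Sp_adjr x y : b x (u y) = b (v x) y.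
Proof. by rewrite -{1}[x]Sp_invK Sp_form. Qed.

(** It is [u^-1 (u - 1)^2], whence the name. *)
Definition quad : 'End(V) := u + v - \1%VF *+ 2.

Lemma quadE x : quad x = u x + v x - (x + x).
Proof.
by rewrite /quad mulr2n add_lfunE opp_lfunE !add_lfunE id_lfunE.
Qed.

Definition shift : 'End(V) := u - \1%VF.
Definition coshift : 'End(V) := \1%VF - v.

Lemma shiftE x : shift x = u x - x.
Proof. by rewrite /shift add_lfunE opp_lfunE id_lfunE. Qed.

Lemma coshiftE x : coshift x = x - v x.
Proof. by rewrite /coshift add_lfunE opp_lfunE id_lfunE. Qed.

Lemma u_shift x : u x = x + shift x.
Proof. by rewrite shiftE addrC subrK. Qed.

Lemma v_coshift_diff x : v x = x - coshift x.
Proof. by rewrite coshiftE opprB addrC subrK. Qed.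

Lemma shift_coshift x : shift (coshift x) = quad x.
Proof.
rewrite shiftE coshiftE quadE linearB /= Sp_invK.
by rewrite opprB opprD !addrA; congr (_ - _); apply: addrAC.
Qed.

Lemma coshift_shift x : coshift (shift x) = quad x.
Proof.
rewrite shiftE coshiftE quadE linearB /= Sp_invKl.
by rewrite opprB opprD !addrA; congr (_ - _); apply: addrAC.
Qed.

Lemma u_coshift x : u (coshift x) = shift x.
Proof. by rewrite coshiftE shiftE linearB /= Sp_invK. Qed.

Lemma quad_u x : quad (u x) = u (quad x).
Proof. by rewrite !quadE !linearB !linearD /= Sp_invK Sp_invKl. Qed.

Lemma quad_v x : quad (v x) = v (quad x).
Proof. by rewrite !quadE !linearB !linearD /= Sp_invK Sp_invKl. Qed.

Local Notation "p ** x" := (pact quad p x) (at level 40).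

Lemma pact_u p x : p ** u x = u (p ** x).
Proof. exact/pact_comm/quad_u. Qed.

Lemma pact_v p x : p ** v x = v (p ** x).
Proof. exact/pact_comm/quad_v. Qed.

Lemma pact_shift p x : p ** shift x = shift (p ** x).
Proof. by rewrite !shiftE linearB /= pact_u. Qed.

Lemma shift_adjl x y : b (shift x) y = - b x (coshift y).
Proof. by rewrite shiftE coshiftE formBl formBr Sp_adjl opprB. Qed.

Lemma quad_adj x y : b (quad x) y = b x (quad y).
Proof.
rewrite !quadE !(formBl, formDl, formBr, formDr) Sp_adjl Sp_adjr.
by rewrite [b _ (v y) + _]addrC.
Qed.

Lemma pact_adj p x y : b (p ** x) y = b x (p ** y).
Proof.
elim/poly_ind: p x y => [|p c IHp] x y.
  by rewrite -(scale0r 0) !pactZ !scale0r skewC !form0r oppr0.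
rewrite !pactD !pactC !pactMX formDl formDr formZl formZr IHp quad_adj.
by rewrite (pact_comm p (h := quad)).
Qed.

(** Polynomials in [quad] are self-adjoint and the form alternates, so that
    [b (p x) x = b x (p x) = - b (p x) x]. *)
Lemma form_cyclic f g x : b (f ** x) (g ** x) = 0.
Proof.
suffices fx0 p : b (p ** x) x = 0 by rewrite -pact_adj -pactM fx0.
have /eqP := pact_adj p x x; rewrite (skewC b x) -addr_eq0 -mulr2n -mulr_natl.
by rewrite mulf_eq0 (negPf two_neq0) => /eqP.
Qed.

(** Nondegeneracy of [P + Q] is what allows the orthogonal complement to be
    split off and the pair to be enlarged inside it. *)
Definition adapted P Q :=
  [/\ isotropic b P, isotropic b Q, {in P, forall x, shift x \in Q},
      {in Q, forall y, coshift y \in P} & nondeg_on b (P + Q)].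

Lemma adapted_cap P Q : adapted P Q -> (P :&: Q = 0)%VS.
Proof.
move=> [Piso Qiso _ _ PQn]; apply/eqP; rewrite -subv0; apply/subvP=> x.
case/memv_capP=> Px Qx; rewrite memv0; apply/eqP/PQn.
  by rewrite (subvP (addvSl _ _)).
by move=> _ /memv_addP[y Py [z Qz ->]]; rewrite formDr Piso // Qiso // addr0.
Qed.

Definition is_isometry (w : 'End(V)) := forall x y, b (w x) (w y) = b x y.

(** A vector in the kernel would lie in the radical of [b]. *)
Lemma isometry_Sp w : is_isometry w -> in_Sp b w.
Proof.
move=> w_iso; split=> //; apply/eqP; rewrite -subv0; apply/subvP=> x.
rewrite memv_ker memv0 => /eqP wx0; apply/eqP/(nondeg_full b_nondeg).
  exact: memvf.
by move=> y _; rewrite -w_iso wx0 skewC form0r oppr0.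
Qed.

(** For [y + z] and [y' + z'] in [P + Q], [b (u y + z) (u y' + z')] has the same
    cross terms as [b (y + z) (y' + z')], because [u y - y] and [z'] both lie in
    the isotropic [Q]; so [1 + a] is an isometry.  Then so is
    [1 + c = (1 + a)^-1 u]. *)
Lemma adapted_prod_two_U2 P Q : adapted P Q -> (P + Q)%VS = fullv ->
  prod_two_U2 (in_Sp b) u.
Proof.
move=> PQ_ad PQ_full; have PQ0 := adapted_cap PQ_ad.
have QP0 : (Q :&: P = 0)%VS by rewrite capvC.
have [Piso Qiso shP cshQ _] := PQ_ad.
pose a := (shift \o daddv_pi P Q)%VF; pose c := (coshift \o daddv_pi Q P)%VF.
have aP x : x \in P -> a x = shift x.
  by move=> Px; rewrite comp_lfunE daddv_pi_id.
have cQ x : x \in Q -> c x = coshift x.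
  by move=> Qx; rewrite comp_lfunE daddv_pi_id.
have decomp x : exists y z, [/\ x = y + z, y \in P & z \in Q].
  have: x \in (P + Q)%VS by rewrite PQ_full memvf.
  by case/memv_addP=> y Py [z Qz ->]; exists y, z.
have pi0 (S T : {vspace V}) x :
    (S :&: T = 0)%VS -> x \in T -> daddv_pi S T x = 0.
  move=> ST0 Tx; have := daddv_pi_add ST0 (subvP (addvSr S T) _ Tx).
  rewrite (daddv_pi_id _ Tx) 1?capvC // => /eqP.
  by rewrite -{3}[x]add0r (inj_eq (addIr _)) => /eqP.
have aQ x : x \in Q -> a x = 0 by move=> Qx; rewrite comp_lfunE pi0 ?linear0.
have cP x : x \in P -> c x = 0 by move=> Px; rewrite comp_lfunE pi0 ?linear0.
have aE y z : y \in P -> z \in Q -> (\1%VF + a : 'End(V)) (y + z) = u y + z.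
  move=> Py Qz; rewrite add_lfunE id_lfunE (linearD a) /= aP // aQ // addr0.
  by rewrite u_shift addrAC.
have cE y z : y \in P -> z \in Q ->
    (\1%VF + c : 'End(V)) (y + z) = y + coshift z + z.
  move=> Py Qz; rewrite add_lfunE id_lfunE (linearD c) /= cP // cQ // add0r.
  by rewrite addrAC.
have a_iso : is_isometry (\1%VF + a).
  move=> x x'; have [y [z [-> Py Qz]]] := decomp x.
  have [y' [z' [-> Py' Qz']]] := decomp x'.
  rewrite !aE // !formDl !formDr Sp_form; congr (_ + _ + (_ + _)).
    by rewrite u_shift formDl (Qiso _ _ (shP y Py) Qz') addr0.
  by rewrite u_shift formDr (Qiso _ _ Qz (shP y' Py')) addr0.
have uE : u = ((\1 + a) \o (\1 + c))%VF.
  apply/lfunP=> x; rewrite comp_lfunE; have [y [z [-> Py Qz]]] := decomp x.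
  rewrite cE // aE ?rpredD ?cshQ // !linearD /= u_coshift -addrA.
  by congr (_ + _); rewrite u_shift addrC.
have c_iso : is_isometry (\1%VF + c).
  by move=> x y; rewrite -a_iso -!comp_lfunE -uE Sp_form.
have U2 (d : 'End(V)) : is_isometry (\1%VF + d) -> (forall x, d (d x) = 0) ->
    is_U2 (\1%VF + d).
  move=> /isometry_Sp[d_GL _] dd0; split=> //; rewrite addrC addKr.
  by apply/lfunP=> x; rewrite comp_lfunE dd0 zero_lfunE.
exists (\1%VF + a), (\1%VF + c); split=> //; try exact: isometry_Sp.
  apply: U2 => // x; have [y [z [-> Py Qz]]] := decomp x.
  by rewrite (linearD a) /= (aP y Py) (aQ z Qz) addr0 aQ ?shP.
apply: U2 => // x; have [y [z [-> Py Qz]]] := decomp x.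
by rewrite (linearD c) /= (cQ z Qz) (cP y Py) add0r cP ?cshQ.
Qed.

End Isometry.

(** * Jordan cells *)
Section JordanCell.

Variables (F : fieldType) (V : vectType F) (u M : 'End(V)) (a : F) (k : nat).
Hypothesis uE : forall x, u x = a *: x + M x.
Hypothesis k_gt0 : (0 < k)%N.
Implicit Types (x y z : V).

Let iter0 i : iter i M 0 = 0.
Proof. by elim: i => //= i ->; rewrite linear0. Qed.

Let iter_ge i j x : iter i M x = 0 -> (i <= j)%N -> iter j M x = 0.
Proof. by move=> Mx0 le_ij; rewrite -(subnK le_ij) iterD Mx0 iter0. Qed.

Lemma jordan_block_sum (e : k.-tuple V) (j : 'I_k) :
  \sum_(i < k) jordan_block k a i j *: tnth e i =
  a *: e`_j + (if (j : nat) is j'.+1 then e`_j' else 0 : V).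
Proof.
under eq_bigr => i _ do rewrite mxE scalerDl (tnth_nth 0).
rewrite big_split (bigD1 j) //= eqxx big1 => [|i /negPf->]; last exact: scale0r.
rewrite addr0; congr (_ + _); case: j => -[|j] lt_jk /=.
  by rewrite big1 // => i _; rewrite scale0r.
rewrite (bigD1 (Ordinal (ltnW lt_jk))) //= eqxx scale1r big1 ?addr0 // => i.
by rewrite -val_eqE eqSS /= => /negPf->; rewrite scale0r.
Qed.

(** A linear form [l] that vanishes on the image of [M^k] but not at [M^(k-1) x]
    provides the stable complement: the common kernel of the [l M^i], [i < k],
    which is stable because [l M^k = 0].  The matrix of the values
    [l (M^i e_j)] on the cell is triangular with nonzero diagonal, so this kernel
    meets the cell trivially, and it has codimension at most [k]. *)
Lemma jordan_cell_of_vector x : iter k M x = 0 ->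
  (forall y, iter k.-1 M x <> iter k M y) -> has_jordan_cell u k a.
Proof.
move=> Mx0 x_out; split=> //; set z := iter k.-1 M x.
pose D := limg (pact M 'X^k).
have [|l lD lz] := @separating_form _ _ D z.
  by apply/negP=> /memv_imgP[y _ /esym]; rewrite pactXn => /esym/x_out.
have lMk y : l (iter k M y) = 0.
  by rewrite lD // -pactXn memv_img ?memvf.
pose T y : 'rV[F]_k := \row_i l (pact M 'X^i y).
have Tlin : linear T.
  by move=> c y y'; apply/rowP=> i; rewrite !mxE linearP /= linearP.
pose Tm := GRing.isLinear.Build _ _ _ _ T Tlin.
pose TL : {linear V -> 'rV[F]_k} := HB.pack T Tm.
pose W' := lker (linfun TL).
have W'P y : reflect (forall i, (i < k)%N -> l (iter i M y) = 0) (y \in W').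
  rewrite memv_ker lfunE /=; apply: (iffP eqP) => [Ty0 i lt_ik|y0].
    by move/rowP/(_ (Ordinal lt_ik)): Ty0; rewrite !mxE pactXn.
  by apply/rowP=> i; rewrite !mxE pactXn y0.
pose e := [tuple iter (k.-1 - j) M x | j < k].
have eE (j : 'I_k) : e`_j = iter (k.-1 - j) M x.
  by rewrite -tnth_nth tnth_mktuple.
(* [e_j] is [M^(k-1-j) x].  Applying [l M^j] kills the terms of index [i < j],
   as [M^k x = 0], and those of index [i > j] have zero coefficient by induction
   from the top index. *)
have e_indep (c : 'I_k -> F) : \sum_j c j *: e`_j \in W' -> forall j, c j = 0.
  move=> /W'P cW' j.
  elim/ltn_ind: {j}(k.-1 - j)%N {-2}j (erefl (k.-1 - j)%N) => n IHn j jn.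
  have := cW' j (ltn_ord j).
  rewrite -pactXn !linear_sum (bigD1 j) //= big1 => [|i ij].
    rewrite addr0 !linearZ /= pactXn eE -iterD subnKC -/z; last first.
      by rewrite -ltnS prednK.
    by move/eqP; rewrite mulf_eq0 (negPf lz) orbF => /eqP.
  rewrite !linearZ /=; have [lt_ji|lt_ij|eq_ij] := ltngtP j i.
  - rewrite (IHn (k.-1 - i)%N) ?scale0r //.
    by have := ltn_ord i; lia.
  - rewrite pactXn eE -iterD (iter_ge Mx0) ?linear0 ?scaler0 //.
    by have := ltn_ord i; have := ltn_ord j; lia.
  - by case/eqP: ij; apply/val_inj.
have e_free : free e.
  by apply/freeP=> c /= c0; apply: e_indep; rewrite c0 mem0v.
have e_basis : basis_of <<e>> e by rewrite /basis_of eqxx.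
have W'0 : (<<e>> :&: W' = 0)%VS.
  apply/eqP; rewrite -subv0; apply/subvP=> y /memv_capP[/coord_span->].
  by move=> /e_indep c0; rewrite big1 ?mem0v // => j _; rewrite c0 scale0r.
have ue (j : 'I_k) :
    u (tnth e j) = \sum_(i < k) jordan_block k a i j *: tnth e i.
  rewrite jordan_block_sum (tnth_nth 0) uE; congr (_ + _).
  rewrite eE -iterS; case: j => -[|j] lt_jk /=.
    by rewrite subn0 -iterS prednK.
  by rewrite (eE (Ordinal (ltnW lt_jk))) /= -iterS; congr (iter _ M x); lia.
exists <<e>>%VS, W', e; split=> //.
- split; first exact/directv_addP.
  apply/eqP; rewrite eqEdim subvf dimv_disjoint_sum // (size_basis e_basis).
  rewrite -(limg_ker_dim (linfun TL) fullv) capfv addnC leq_add2r.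
  by rewrite (leq_trans (dimvS (subvf _))) // dimvf /dim /= mul1n.
- rewrite limg_span; apply/span_subvP=> _ /mapP[_ /tnthP[j ->] ->].
  by rewrite ue rpred_sum // => i _; rewrite rpredZ // memv_span ?mem_tnth.
- apply/subvP=> _ /memv_imgP[y /W'P W'y ->].
  rewrite uE rpredD ?rpredZ //; first exact/W'P.
  apply/W'P=> i lt_ik; rewrite -iterSr; have [/W'y //|le_ki] := ltnP i.+1 k.
  by rewrite (_ : i.+1 = k) ?lMk //; apply/eqP; rewrite eqn_leq lt_ik.
Qed.

(** On the cell [M^k = 0]; so if the first basis vector [M^(k-1) x] were in the
    image of [M^k], it would come from the stable complement and lie in it. *)
Lemma jordan_cell_vector : has_jordan_cell u k a ->
  exists x, M (iter k.-1 M x) = 0 /\ forall y, iter k.-1 M x <> iter k M y.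
Proof.
case=> _ [W [W' [e [[/directv_addP WW'0 WW'] uW uW' e_basis ue]]]].
have Me (j : 'I_k) : M e`_j = if (j : nat) is j'.+1 then e`_j' else 0 : V.
  by have := ue j; rewrite jordan_block_sum (tnth_nth 0) uE => /addrI.
have iterMe j i : (i + j < k)%N -> iter i M e`_(i + j) = e`_j.
  elim: i => // i IHi lt_ijk.
  by rewrite iterSr (Me (Ordinal lt_ijk)) /= IHi // ltnW.
have e0 : iter k.-1 M e`_k.-1 = e`_0.
  by rewrite -{2}[k.-1]addn0 iterMe // addn0 prednK.
exists e`_k.-1; rewrite e0; split=> [|y De0]; first exact: (Me (Ordinal k_gt0)).
have MkW x : x \in W -> iter k M x = 0.
  move=> Wx; rewrite (coord_basis e_basis Wx) -pactXn linear_sum big1 // => j _.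
  rewrite linearZ /= pactXn; suffices -> : iter k M e`_j = 0 by rewrite scaler0.
  apply: (@iter_ge j.+1) => //.
  by rewrite iterS -{2}[val j]addn0 iterMe ?addn0 // (Me (Ordinal k_gt0)).
have MW' i x : x \in W' -> iter i M x \in W'.
  move=> W'x; elim: i => //= i W'i.
  have -> : M (iter i M x) = u (iter i M x) - a *: iter i M x.
    by rewrite uE [_ + M _]addrC addrK.
  by rewrite rpredB ?rpredZ // (subvP uW') ?memv_img.
have: y \in (W + W')%VS by rewrite WW' memvf.
case/memv_addP=> y1 Wy1 [y2 W'y2 Dy].
have W'e0 : e`_0 \in W'.
  by rewrite De0 Dy -pactXn linearD /= !pactXn MkW // add0r MW'.
have e0_in : e`_0 \in e by rewrite mem_nth // size_tuple.
have: e`_0 \in (W :&: W')%VS by rewrite memv_cap W'e0 (basis_mem e_basis).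
by rewrite WW'0 memv0 (negPf (basis_not0 e_basis e0_in)).
Qed.

End JordanCell.

(** * Products of two unipotent elements of index two *)
Section ProductOfTwoU2.

Variables (F : fieldType) (V : vectType F) (u u1 u2 : 'End(V)).
Hypothesis two_neq0 : 2%:R != 0 :> F.
Hypotheses (u_GL : in_GL u) (u1_U2 : is_U2 u1) (u2_U2 : is_U2 u2).
Hypothesis u_prod : u = (u1 \o u2)%VF.
Implicit Types (x y z : V).

Local Notation v := (u^-1)%VF.
Local Notation a := (u1 - \1%VF).
Local Notation c := (u2 - \1%VF).

Let uK : cancel u v. Proof. by apply/lker0_lfunK/eqP. Qed.
Let vK : cancel v u. Proof. by apply/lker0_lfunVK/eqP. Qed.

Let aa x : a (a x) = 0.
Proof. by case: u1_U2 => _ /lfunP/(_ x); rewrite comp_lfunE zero_lfunE. Qed.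

Let cc x : c (c x) = 0.
Proof. by case: u2_U2 => _ /lfunP/(_ x); rewrite comp_lfunE zero_lfunE. Qed.

Let u1E x : u1 x = x + a x.
Proof. by rewrite add_lfunE opp_lfunE id_lfunE addrC subrK. Qed.

Let u2E x : u2 x = x + c x.
Proof. by rewrite add_lfunE opp_lfunE id_lfunE addrC subrK. Qed.

Let uE x : u x = u1 (u2 x). Proof. by rewrite u_prod comp_lfunE. Qed.

Let u2c x : u2 (c x) = c x. Proof. by rewrite u2E cc addr0. Qed.

Let u1K x : u1 (x - a x) = x.
Proof. by rewrite u1E linearB /= aa subr0 subrK. Qed.

Let vc x : v (c x) = c x - a (c x) + c (a (c x)).
Proof.
apply: (can_inj uK); rewrite vK uE; set y := c x.
suffices -> : u2 (y - a y + c (a y)) = y - a y by rewrite u1K.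
by rewrite linearD /= linearB /= !u2c -/y (u2E (a y)) opprD addrA subrK.
Qed.

Let cv x : c (v x) = c x - c (a x).
Proof.
have {1}-> : v x = x - a x - c (x - a x).
  apply: (can_inj uK); rewrite vK uE (linearB u2) /= u2c u2E addrK.
  by rewrite u1K.
by rewrite linearB /= cc subr0 linearB.
Qed.

Let uc x : u (c x) = c x + a (c x). Proof. by rewrite uE u2c u1E. Qed.

Let cu x : c (u x) = c x + (c (a x) + c (a (c x))).
Proof.
have uxE : u x = u2 x + a (u2 x) by rewrite uE u1E.
rewrite uxE u2E (linearD c) (linearD c x) (linearD a) (linearD c) /=.
by rewrite cc addr0.
Qed.

Definition symtrace x := u x + v x + (x + x).

Let symtrace_u x : symtrace (u x) = u (symtrace x).
Proof. by rewrite /symtrace !linearD /= uK vK. Qed.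

Let symtrace_v x : symtrace (v x) = v (symtrace x).
Proof. by rewrite /symtrace !linearD /= uK vK. Qed.

(** Both sides are [4 c x + c a c x], as [symtrace = a c + c a + 4]. *)
Let symtrace_c x : c (symtrace x) = symtrace (c x).
Proof.
rewrite /symtrace !(linearD c) /=; congr (_ + _).
rewrite cu uc cv vc addrACA [c (a x) + _]addrC addrK.
by rewrite !addrA [c x + _ + c x]addrAC addrK.
Qed.

Definition plus1 : 'End(V) := u + \1%VF.

(** [(u + 1)^2] is [u] composed with [symtrace], so it commutes with [d] up to
    conjugating [d] by [u], which preserves the hypothesis on [d]. *)
Lemma plus1_image (d : V -> V) m x :
  (forall x, d (symtrace x) = symtrace (d x)) ->
  exists y, d (iter m.*2 plus1 x) = iter m.*2 plus1 y.
Proof.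
have p1E z : plus1 (plus1 z) = u (symtrace z).
  rewrite /plus1 !add_lfunE !id_lfunE linearD /= /symtrace !linearD /= vK.
  by rewrite [RHS]addrACA [z + _]addrC.
elim: m d x => [|m IHm] d x ds; first by exists (d x).
rewrite doubleS /= p1E.
have [|y Dy] := IHm (fun z => v (d (u z))) x.
  by move=> z; rewrite -symtrace_u ds symtrace_v.
exists y; rewrite -Dy p1E symtrace_v vK.
by rewrite -ds symtrace_u.
Qed.

(** From [u y = - y] one gets [c y = a y - 2 y], hence [a c y = - 2 a y] and
    [(u + 1) (c y) = 2 c y + a c y = - 4 y]; and [c y] is again in the image of
    [(u + 1)^(2m)]. *)
Lemma plus1_kernel_image y m x : y = iter m.*2 plus1 x -> plus1 y = 0 ->
  exists z, y = iter m.*2.+1 plus1 z.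
Proof.
move=> Dy; rewrite {1}/plus1 add_lfunE id_lfunE => /eqP.
rewrite addr_eq0 => /eqP uy.
have [z Dz] := plus1_image m x symtrace_c.
have four_neq0 : 2%:R * 2%:R != 0 :> F by rewrite mulf_neq0.
have u2y : u2 y = a y - y.
  have u1Kl x' : u1 x' - a (u1 x') = x'.
    by rewrite u1E linearD /= aa addr0 addrK.
  by rewrite -(u1Kl (u2 y)) -uE uy linearN /= opprK addrC.
have cy : c y = a y - (y + y).
  by rewrite opprD addrA -u2y u2E [y + _]addrC addrK.
have acy : a (c y) = - (a y + a y).
  by rewrite cy linearB linearD /= aa sub0r.
have -> : y = (- (2%:R * 2%:R)^-1 : F) *: plus1 (c y).
  have -> : plus1 (c y) = - (2%:R * 2%:R : F) *: y.
    rewrite /plus1 add_lfunE id_lfunE uc acy cy addrAC addrACA.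
    rewrite [a y + a y + _]addrC addrK -opprD scaleNr -scalerA.
    by rewrite !scaler_nat !mulr2n.
  by rewrite scalerA mulrNN mulVf // scale1r.
exists (- (2%:R * 2%:R)^-1 *: z).
by rewrite iterS -pactXn linearZ linearZ /= pactXn -Dz -Dy.
Qed.

End ProductOfTwoU2.

(** * Building adapted pairs *)
Section AdaptedPairs.

Variables (F : fieldType) (V : vectType F) (b : {skew_symmetric V}).
Hypothesis two_neq0 : 2%:R != 0 :> F.
Hypothesis b_nondeg : nondegenerate b.
Variable u : 'End(V).
Hypothesis u_Sp : in_Sp b u.
Implicit Types (x y z : V) (D E P Q U : {vspace V}).
Implicit Types (f g h p r : {poly F}).

Local Notation v := (u^-1)%VF.
Local Notation quad := (quad u).
Local Notation shift := (shift u).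
Local Notation coshift := (coshift u).
Local Notation adapted := (adapted b u).
Local Notation "p ** x" := (pact quad p x) (at level 40).

Definition stable U :=
  {in U, forall x, u x \in U} /\ {in U, forall x, v x \in U}.

Lemma v_shift x : v (shift x) = coshift x.
Proof. by rewrite -(u_coshift u_Sp) (Sp_invKl u_Sp). Qed.

Lemma stable_pair P Q : {in P, forall x, shift x \in Q} ->
  {in Q, forall y, coshift y \in P} -> stable (P + Q).
Proof.
move=> shP cshQ.
have inP x : x \in P -> x \in (P + Q)%VS by apply/subvP/addvSl.
have inQ x : x \in Q -> x \in (P + Q)%VS by apply/subvP/addvSr.
have uP x : x \in P -> u x \in (P + Q)%VS.
  by move=> Px; rewrite (u_shift u) rpredD ?(inP x) // inQ ?shP.
have vQ x : x \in Q -> v x \in (P + Q)%VS.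
  by move=> Qx; rewrite (v_coshift_diff u) rpredB ?(inQ x) // inP ?cshQ.
split=> _ /memv_addP[x Px [y Qy ->]];
  rewrite linearD rpredD ?(uP x) ?(vQ y) //=.
  by rewrite (u_shift u) -(u_coshift u_Sp) rpredD ?(inQ y) // uP ?cshQ.
by rewrite (v_coshift_diff u) -v_shift rpredB ?(inP x) // vQ ?shP.
Qed.

Lemma stable_orthov E : stable E -> stable (orthov b E).
Proof.
case=> uE vE; split=> x /mem_orthovP xE; apply/mem_orthovP=> y Ey.
  by rewrite (Sp_adjl u_Sp) xE ?vE.
by rewrite -(Sp_adjr u_Sp) xE ?uE.
Qed.

Lemma shift_coshift_quad x : shift x = coshift x + quad x.
Proof. by rewrite -(u_coshift u_Sp) (u_shift u) (shift_coshift u_Sp). Qed.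

Section StableSubspace.

Variable U : {vspace V}.
Hypothesis U_stable : stable U.

Lemma stable_shift x : x \in U -> shift x \in U.
Proof. by case: U_stable => uU _ Ux; rewrite shiftE rpredB ?uU. Qed.

Lemma stable_coshift x : x \in U -> coshift x \in U.
Proof. by case: U_stable => _ vU Ux; rewrite coshiftE rpredB ?vU. Qed.

Lemma stable_quad x : x \in U -> quad x \in U.
Proof.
by case: U_stable => uU vU Ux; rewrite quadE !(rpredB, rpredD) ?uU ?vU.
Qed.

Lemma stable_pact p x : x \in U -> p ** x \in U.
Proof. exact/pact_stable/stable_quad. Qed.

Lemma stable_cyclic x : x \in U -> (cyclic quad x <= U)%VS.
Proof. by move=> Ux; apply/subvP=> _ /cyclicP[f ->]; apply: stable_pact. Qed.

End StableSubspace.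

Lemma mem_cyclic f x : f ** x \in cyclic quad x.
Proof. by apply/cyclicP; exists f. Qed.

Lemma cyclic_self x : x \in cyclic quad x.
Proof. by rewrite -{1}[x](pact1 quad) mem_cyclic. Qed.

Lemma cyclic_isotropic x : isotropic b (cyclic quad x).
Proof.
by move=> _ _ /cyclicP[f ->] /cyclicP[g ->]; apply: (form_cyclic two_neq0 u_Sp).
Qed.

Lemma pact_quad f x : quad (f ** x) = (f * 'X) ** x.
Proof. by rewrite pactMX (pact_comm f (h := quad)). Qed.

Lemma shift_cyclic_isotropic x : isotropic b (shift @: cyclic quad x).
Proof.
move=> _ _ /memv_imgP[_ /cyclicP[f ->] ->] /memv_imgP[_ /cyclicP[g ->] ->].
rewrite (shift_adjl u_Sp) (coshift_shift u_Sp) pact_quad.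
by rewrite (form_cyclic two_neq0 u_Sp) oppr0.
Qed.

Lemma coshift_cyclic_isotropic x : isotropic b (coshift @: cyclic quad x).
Proof.
move=> _ _ /memv_imgP[_ /cyclicP[f ->] ->] /memv_imgP[_ /cyclicP[g ->] ->].
apply: oppr_inj; rewrite -(shift_adjl u_Sp) (shift_coshift u_Sp) pact_quad.
by rewrite (form_cyclic two_neq0 u_Sp) oppr0.
Qed.

(** With [L] the cyclic module of [x], the pairing of [f x] with [shift (g x)] is
    [b (f g x) (u x)], as [b] vanishes on [L].  The last hypothesis says that the
    linear form [f |-> b (f x) (u x)] does not vanish on the multiples of [r^n],
    so [L] and [shift L] are in perfect duality. *)
Lemma adapted_cyclic r n h x : irreducible_poly r -> r ^+ n.+1 ** x = 0 ->
  b ((r ^+ n * h) ** x) (u x) != 0 ->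
  adapted (cyclic quad x) (shift @: cyclic quad x).
Proof.
move=> r_irr rx0 rhx_neq0.
have rx_neq0 : r ^+ n ** x != 0.
  apply: contraNneq rhx_neq0 => rx0'.
  by rewrite mulrC pactM rx0' linear0 skewC form0r oppr0.
have pairing f : (forall g, b (f ** x) (shift (g ** x)) = 0) -> f ** x = 0.
  move=> fx0; apply: contraNeq rhx_neq0 => fx_neq0.
  have [g Dg] := pact_socle r_irr rx0 fx_neq0.
  rewrite mulrC pactM -Dg -pactM mulrA mulrC pactM (pact_adj u_Sp).
  rewrite -(pact_adj u_Sp) pactMC (pact_adj u_Sp) (pact_u u_Sp) (u_shift u).
  by rewrite formDr fx0 (form_cyclic two_neq0 u_Sp) addr0.
split.
- exact: cyclic_isotropic.
- exact: shift_cyclic_isotropic.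
- by move=> y Ly; apply: memv_img.
- move=> _ /memv_imgP[_ /cyclicP[f ->] ->].
  by rewrite (coshift_shift u_Sp) pact_quad mem_cyclic.
move=> t /memv_addP[_ /cyclicP[f ->]].
case=> _ /memv_imgP[_ /cyclicP[g ->] ->] -> rad.
have fx0 : f ** x = 0.
  apply: pairing => h'; have := rad (shift (h' ** x)).
  have gh0 : b (shift (g ** x)) (shift (h' ** x)) = 0.
    by apply: (@shift_cyclic_isotropic x); rewrite memv_img ?mem_cyclic.
  rewrite formDl gh0 addr0; apply.
  by rewrite (subvP (addvSr _ _)) // memv_img ?mem_cyclic.
rewrite fx0 add0r; rewrite pairing ?linear0 // => h'.
(* The roles of [L] and [shift L] are exchanged by adjunction, at the cost of a
   [coshift], which differs from [shift] by an operator that preserves [L]. *)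
rewrite shift_coshift_quad formDr pact_quad (form_cyclic two_neq0 u_Sp) addr0.
apply: oppr_inj; rewrite -(shift_adjl u_Sp) oppr0 -[shift _]add0r -fx0 rad //.
by rewrite (subvP (addvSl _ _)) ?mem_cyclic.
Qed.

(** When [shift quad^n x = 0], the module generated by [x] under [u] has odd
    dimension [2n+1], so the form degenerates on it, and two such modules have to
    be put in duality. *)
Section HyperbolicPair.

Variables (n : nat) (x y : V).
Hypotheses (shqx0 : shift ('X^n ** x) = 0) (shqy0 : shift ('X^n ** y) = 0).
Hypothesis xy_neq0 : b ('X^n ** x) y != 0.
Hypothesis shx_y : forall f, b (shift (f ** x)) y = 0.

Let P := (cyclic quad x + (coshift @: cyclic quad y))%VS.
Let Q := (cyclic quad y + (shift @: cyclic quad x))%VS.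
Let E := (P + Q)%VS.

Let shP : {in P, forall z, shift z \in Q}.
Proof.
move=> _ /memv_addP[z xz [_ /memv_imgP[_ /cyclicP[g ->] ->] ->]].
rewrite linearD /= (shift_coshift u_Sp) pact_quad addrC.
by rewrite memv_add ?mem_cyclic // memv_img.
Qed.

Let cshQ : {in Q, forall z, coshift z \in P}.
Proof.
move=> _ /memv_addP[z yz [_ /memv_imgP[_ /cyclicP[g ->] ->] ->]].
rewrite linearD /= (coshift_shift u_Sp) pact_quad addrC.
by rewrite memv_add ?mem_cyclic // memv_img.
Qed.

Let E_stable : stable E. Proof. exact: stable_pair. Qed.

Let Ex f : f ** x \in E.
Proof. exact/(subvP (addvSl _ _))/(subvP (addvSl _ _))/mem_cyclic. Qed.

Let Ey f : f ** y \in E.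
Proof. exact/(subvP (addvSr _ _))/(subvP (addvSl _ _))/mem_cyclic. Qed.

Lemma pact_head f z : exists c g, f ** z = c *: z + shift (coshift (g ** z)).
Proof.
elim/poly_ind: f => [|g c _].
  by exists 0, 0; rewrite -(scale0r 0) !pactZ !scale0r !linear0 addr0.
exists c, g; rewrite pactD pactC (shift_coshift u_Sp) pact_quad addrC.
by [].
Qed.

(** Everything in [E] except the constant terms of the polynomials applied to [x]
    and [y] is in the image of [shift], since [quad] and [coshift] factor through
    it. *)
Let E_head w : w \in E ->
  exists c d, exists2 e, e \in E & w = c *: x + d *: y + shift e.
Proof.
case/memv_addP=> s /memv_addP[_ /cyclicP[f ->]].
case=> _ /memv_imgP[_ /cyclicP[k ->] ->] -> [t /memv_addP[_ /cyclicP[h ->]]].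
case=> _ /memv_imgP[_ /cyclicP[g ->] ->] -> ->.
have [c [f' ->]] := pact_head f x; have [d [h' ->]] := pact_head h y.
exists c, d, (coshift (f' ** x) + v (k ** y) + (coshift (h' ** y) + g ** x)).
  have [_ vE] := E_stable.
  have cshx := stable_coshift E_stable (Ex f').
  have cshy := stable_coshift E_stable (Ey h').
  exact: rpredD (rpredD cshx (vE _ (Ey k))) (rpredD cshy (Ex g)).
have <- : shift (v (k ** y)) = coshift (k ** y).
  by rewrite shiftE coshiftE (Sp_invK u_Sp).
rewrite !linearD /= -!addrA; congr (_ + _).
by rewrite [X in _ + X = _]addrCA [LHS]addrCA.
Qed.

Lemma shift_iter_double m z : iter m.*2 shift z = iter m u ('X^m ** z).
Proof.
have shsh t : shift (shift t) = u (quad t).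
  by rewrite -(u_coshift u_Sp) (coshift_shift u_Sp).
elim: m z => [|m IHm] z; first by rewrite pact1.
rewrite doubleS !iterSr shsh IHm (pact_u u_Sp).
by rewrite exprSr pactMX.
Qed.

Let top z : shift ('X^n ** z) = 0 -> iter n.*2 shift z = 'X^n ** z.
Proof.
move=> shz; rewrite shift_iter_double; elim: {1}n => //= m ->.
by apply/eqP; rewrite -subr_eq0 -shiftE shz.
Qed.

Let E_top w : w \in E -> iter n.*2.+1 shift w = 0.
Proof.
have pact_top f z : shift ('X^n ** z) = 0 -> iter n.*2.+1 shift (f ** z) = 0.
  move=> shz; rewrite -pactXn pact_comm => [|t].
    by rewrite pactXn iterS top // shz linear0.
  by rewrite (pact_shift u_Sp).
have pact_top_shift f z : shift ('X^n ** z) = 0 ->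
    iter n.*2.+1 shift (shift (f ** z)) = 0.
  by move=> shz; rewrite -iterSr iterS pact_top ?linear0.
case/memv_addP=> s /memv_addP[_ /cyclicP[f ->]].
case=> _ /memv_imgP[_ /cyclicP[k ->] ->] -> [t /memv_addP[_ /cyclicP[h ->]]].
case=> _ /memv_imgP[_ /cyclicP[g ->] ->] -> ->.
have -> : coshift (k ** y) = shift (k ** y) - quad (k ** y).
  by rewrite shift_coshift_quad addrK.
rewrite pact_quad -!pactXn !(linearD, linearN) /= !pactXn.
by rewrite !pact_top // !pact_top_shift // oppr0 !addr0.
Qed.

(** Isotropy comes from the orthogonality of [y] to [shift F[quad] x].
    For nondegeneracy, a vector [z] of the radical lies in [shift^j E] for every
    [j]: if [z = shift^j (c x + d y + shift e)], then
    [shift^(2n - j) z = c quad^n x + d quad^n y] is in the radical too, and pairing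
    it with [y] and [x] gives [c = d = 0]. *)
Lemma adapted_hyperbolic : adapted P Q.
Proof.
have xy0 f g : b (shift (f ** x)) (g ** y) = 0.
  by rewrite -(pact_adj u_Sp) (pact_shift u_Sp) -pactM shx_y.
split=> //.
- apply: isotropic_add; first exact: cyclic_isotropic.
    exact: coshift_cyclic_isotropic.
  move=> _ _ /cyclicP[f ->] /memv_imgP[_ /cyclicP[g ->] ->].
  by apply: oppr_inj; rewrite -(shift_adjl u_Sp) xy0 oppr0.
- apply: isotropic_add; first exact: cyclic_isotropic.
    exact: shift_cyclic_isotropic.
  move=> _ _ /cyclicP[g ->] /memv_imgP[_ /cyclicP[f ->] ->].
  by rewrite skewC xy0 oppr0.
rewrite -/E => z Ez rad.
have shift_rad m t : t \in E -> {in E, forall w, b t w = 0} ->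
    {in E, forall w, b (iter m shift t) w = 0}.
  move=> Et t0; elim: m => //= m IHm w Ew.
  by rewrite (shift_adjl u_Sp) IHm ?oppr0 // (stable_coshift E_stable).
suffices filtration j :
    (j <= n.*2.+1)%N -> exists2 w, w \in E & z = iter j shift w.
  by have [w Ew ->] := filtration _ (leqnn _); apply: E_top.
elim: j => [|j IHj] lt_jn; first by exists z.
have [w Ew Dz] := IHj (ltnW lt_jn).
have [c [d [e Ee Dw]]] := E_head Ew.
have topw : iter (n.*2 - j) shift z = c *: ('X^n ** x) + d *: ('X^n ** y).
  rewrite Dz -iterD subnK // Dw -pactXn !linearD /= (pactXn _ _ (shift e)).
  rewrite -iterSr E_top //.
  by rewrite addr0 !linearZ /= !(pactXn shift) !top.
have rad' t : t \in E -> c * b ('X^n ** x) t + d * b ('X^n ** y) t = 0.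
  by move=> Et; rewrite -!formZl -formDl -topw; apply: shift_rad.
have Ex1 : x \in E by have := Ex 1; rewrite pact1.
have Ey1 : y \in E by have := Ey 1; rewrite pact1.
have self0 t : b ('X^n ** t) t = 0.
  by rewrite -{2}[t](pact1 quad) (form_cyclic two_neq0 u_Sp).
have c0 : c = 0.
  have := rad' y Ey1; rewrite self0 mulr0 addr0 => /eqP.
  by rewrite mulf_eq0 (negPf xy_neq0) orbF => /eqP.
have d0 : d = 0.
  have := rad' x Ex1; rewrite c0 mul0r add0r (pact_adj u_Sp) skewC => /eqP.
  by rewrite mulf_eq0 oppr_eq0 (negPf xy_neq0) orbF => /eqP.
exists e => //; rewrite Dz Dw c0 d0 !scale0r !add0r.
by rewrite iterSr.
Qed.

End HyperbolicPair.

Lemma double_eq0 z : z + z = 0 -> z = 0.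
Proof.
by move/eqP; rewrite -mulr2n -scaler_nat scaler_eq0 (negPf two_neq0) => /eqP.
Qed.

Lemma shift_eq0 z : quad z = 0 -> u z = v z -> shift z = 0.
Proof.
move=> /eqP; rewrite quadE => + uvz; rewrite -uvz opprD addrACA -shiftE => /eqP.
exact: double_eq0.
Qed.

Local Notation M := (plus1 u).
(** As a polynomial in [quad], this is [u + u^-1 + 2 = u^-1 (u + 1)^2]. *)
Definition quad4 : {poly F} := 'X + (2%:R * 2%:R)%:P.

Lemma plus1E z : M z = u z + z.
Proof. by rewrite /plus1 add_lfunE id_lfunE. Qed.

Lemma quad4E z : quad4 ** z = u z + v z + (z + z).
Proof.
rewrite pactD pactX pactC quadE -scalerA !scaler_nat !mulr2n.
by rewrite [LHS]addrA subrK.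
Qed.

Lemma plus1_eq0 z : quad4 ** z = 0 -> u z = v z -> M z = 0.
Proof.
by rewrite quad4E => + uvz; rewrite -uvz addrACA -plus1E => /double_eq0.
Qed.

Lemma plus1_sqr z : M (M z) = u (quad4 ** z).
Proof.
rewrite !plus1E quad4E !linearD /= (Sp_invK u_Sp).
by rewrite [RHS]addrACA [z + _]addrC.
Qed.

Lemma pact_plus1 p z : p ** M z = M (p ** z).
Proof. by rewrite !plus1E linearD /= (pact_u u_Sp). Qed.

Lemma pact_iter p k z : p ** iter k u z = iter k u (p ** z).
Proof. by elim: k => //= k <-; rewrite (pact_u u_Sp). Qed.

Lemma plus1_iter_double m z : iter m.*2 M z = iter m u (quad4 ^+ m ** z).
Proof.
elim: m z => [|m IHm] z; first by rewrite pact1.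
by rewrite doubleS !iterSr plus1_sqr IHm (pact_u u_Sp) exprSr pactM.
Qed.

(** [(u - u^-1)^2 = (u + u^-1)^2 - 4], where [u + u^-1 = quad + 2]. *)
Lemma diff_sqr z : u (u z - v z) - v (u z - v z) = ('X * quad4) ** z.
Proof.
rewrite pactM pactX quad4E; set w := u z + v z.
have -> : quad (w + (z + z)) = u w + v w - (z + z + (z + z)).
  rewrite (linearD quad w) (linearD quad z) /= (quadE u z) -/w (quadE u w).
  by rewrite [w - _ + _]addrACA -opprD [LHS]addrA subrK.
rewrite /w (linearB u) (linearB v) (linearD u) (linearD v) /=.
rewrite (Sp_invK u_Sp) (Sp_invKl u_Sp) opprB.
rewrite addrACA -opprD [z + v (v z)]addrC [X in X - (_ + _ + _)]addrACA.
by rewrite [X in _ = _ + X]opprD [RHS]addrA addrK.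
Qed.

Lemma irreducible_dvd_quad r : r \is monic -> irreducible_poly r ->
  r %| 'X * quad4 -> r = 'X \/ r = quad4.
Proof.
move=> r_monic r_irr r_dvd.
have quad4_sub : quad4 = 'X - (- (2%:R * 2%:R))%:P by rewrite polyCN opprK.
have monic_eq s : s \is monic -> irreducible_poly s -> r %| s -> r = s.
  move=> s_monic s_irr r_s; apply/eqP; rewrite -eqp_monic //.
  by apply: (apply_irredp s_irr) => //; rewrite gtn_eqF //; case: r_irr.
have [rX|rX] := boolP (r %| 'X).
  left; apply: monic_eq; rewrite ?monicX //.
  by rewrite -['X]subr0; apply: irredp_XsubC.
right; apply: monic_eq; rewrite ?quad4_sub ?monicXsubC //.
  exact: irredp_XsubC.
rewrite -quad4_sub; apply: contraLR r_dvd => r4.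
rewrite -irreducible_poly_coprime // coprimepMr.
by rewrite !irreducible_poly_coprime // rX.
Qed.

Section LocalStep.

Variable U : {vspace V}.
Hypotheses (U_stable : stable U) (U_nondeg : nondeg_on b U).

Variables (r m : {poly F}) (n : nat) (x0 : V).
Hypotheses (r_irr : irreducible_poly r) (r_ndvd : ~~ (r %| m)).
Hypothesis mU : {in U, forall x, (r ^+ n.+1 * m) ** x = 0}.
Hypotheses (Ux0 : x0 \in U) (x0_neq0 : (r ^+ n * m) ** x0 != 0).

Definition refinable := exists P Q,
  [/\ adapted P Q, (P <= U)%VS, (Q <= U)%VS & (P + Q != 0)%VS].

Lemma mem_neq0 P x : x \in P -> x != 0 -> (P != 0)%VS.
Proof. by move=> Px; apply: contraNneq => P0; rewrite P0 memv0 in Px. Qed.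

(** Polarization: [phi x = b (r^n c x) (u x)] is a quadratic form whose polar form
    at [x1], [x2] is [b x1 (r^n c (u - u^-1) x2)].  If the latter is nonzero, [phi]
    does not vanish at all three of [x1], [x2], [x1 + x2]. *)
Lemma refinable_generic y : y \in U -> (r ^+ n * m) ** (u y - v y) != 0 ->
  refinable.
Proof.
move=> Uy y_neq0; have [c [d cd1]] := bezout_irreducible r_irr r_ndvd.
have [uU vU] := U_stable.
have Uuvy : u y - v y \in U by rewrite rpredB ?uU ?vU.
have [w Uw] := nondeg_witness U_nondeg (stable_pact U_stable _ Uuvy) y_neq0.
rewrite skewC oppr_eq0.
(* On [U], [c m] acts as the identity up to a multiple of [r]; a second factor
   [m] can thus be inserted, to be moved to the other side of the form. *)
have -> : (r ^+ n * m) ** (u y - v y) = (m * (r ^+ n * c) * m) ** (u y - v y).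
  rewrite -[r ^+ n * m]mulr1 -cd1.
  have -> : r ^+ n * m * (c * m + d * r) =
    m * (r ^+ n * c) * m + d * (r ^+ n.+1 * m) by rewrite exprS; ring.
  by rewrite pactD [(d * _) ** _]pactM mU // linear0 addr0.
rewrite -mulrA pactM -(pact_adj u_Sp) pactM.
pose phi x := b ((r ^+ n * c) ** x) (u x).
set x1 := m ** w; set x2 := m ** y => x12_neq0.
have m_ann t : t \in U -> r ^+ n.+1 ** (m ** t) = 0.
  by move=> Ut; rewrite -pactM mU.
have [x [t Ut Dx] phix] :
    exists2 x, exists2 t, t \in U & x = m ** t & phi x != 0.
  have polar : phi (x1 + x2) = phi x1 + phi x2 +
    b x1 ((r ^+ n * c) ** (m ** (u y - v y))).
    rewrite (linearB (pact quad m)) /= (pact_u u_Sp) (pact_v u_Sp) -/x2 /phi.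
    set e := r ^+ n * c.
    rewrite (linearD (pact quad e)) (linearD u) /= !formDl !formDr.
    have -> : b (e ** x2) (u x1) = - b x1 (e ** v x2).
      by rewrite (Sp_adjr u_Sp) skewC (pact_v u_Sp).
    rewrite (pact_adj u_Sp e x1 (u x2)) (linearB (pact quad e)) /= formBr.
    by rewrite [RHS]addrC addrA; ring.
  have [phi1|phi1] := eqVneq (phi x1) 0; last by exists x1 => //; exists w.
  have [phi2|phi2] := eqVneq (phi x2) 0; last by exists x2 => //; exists y.
  exists (x1 + x2); last by rewrite polar phi1 phi2 !add0r.
  by exists (w + y); rewrite ?rpredD // linearD.
exists (cyclic quad x), (shift @: cyclic quad x)%VS.
have Ux : x \in U by rewrite Dx stable_pact.
have cycU := stable_cyclic U_stable Ux.
split=> //.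
- by apply: adapted_cyclic phix => //; rewrite Dx m_ann.
- apply/subvP=> _ /memv_imgP[z /(subvP cycU) Uz ->].
  exact: stable_shift.
apply: (@mem_neq0 _ x).
  exact/(subvP (addvSl _ _))/cyclic_self.
apply: contraNneq phix => ->.
by rewrite /phi (linear0 (pact quad _)) skewC form0r oppr0.
Qed.

Hypothesis diffU : {in U, forall y, (r ^+ n * m) ** (u y - v y) = 0}.

(** The nonzero vector [r^n m (quad) x0] is killed by [r] and, through
    [(u - u^-1)^2], by [X (X + 4)]; these cannot be coprime. *)
Lemma degenerate_dvd : r %| 'X * quad4.
Proof.
apply: contraT => r_nd; have [c [d cd1]] := bezout_irreducible r_irr r_nd.
have t_ann : ('X * quad4) ** ((r ^+ n * m) ** x0) = 0.
  have uv0 : u ((r ^+ n * m) ** x0) - v ((r ^+ n * m) ** x0) = 0.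
    by rewrite -(pact_u u_Sp) -(pact_v u_Sp) -linearB /= diffU.
  by rewrite -diff_sqr uv0 (linear0 u) (linear0 v) subrr.
have r_ann : r ** ((r ^+ n * m) ** x0) = 0.
  by rewrite -pactM mulrA -exprS mU.
by have /eqP := x0_neq0; case; apply: pact_coprime cd1 t_ann r_ann.
Qed.

Let diff_eq t : t \in U -> u ((r ^+ n * m) ** t) = v ((r ^+ n * m) ** t).
Proof.
move=> Ut; apply/eqP; rewrite -subr_eq0 -(pact_u u_Sp) -(pact_v u_Sp).
by rewrite -linearB /= diffU.
Qed.

(** The line of [z = quad^n x] is not in [shift F[quad] x]: from
    [z = shift (g x)] one gets [quad (g x) = coshift z = 0], so [X^n] divides [g]
    and [shift (g x) = 0].  A vector of [U] orthogonal to [shift F[quad] x] but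
    not to [z] then exists; applying [m c], which is the identity at [z], moves
    it to the primary part of [U] without losing these properties. *)
Lemma refinable_unipotent : r = 'X -> refinable.
Proof.
move=> rX; move: r_irr r_ndvd mU x0_neq0 diff_eq.
rewrite rX => X_irr X_nd XmU xX_neq0 Xdiff.
have [c [d cd1]] := bezout_irreducible X_irr X_nd.
have Xn1 t : t \in U -> 'X^(n.+1) ** (m ** t) = 0.
  by move=> Ut; rewrite -pactM XmU.
have shXn t : t \in U -> shift ('X^n ** (m ** t)) = 0.
  move=> Ut; rewrite -pactM; apply: shift_eq0; last exact: Xdiff.
  by rewrite pact_quad mulrAC -exprSr XmU.
set x := m ** x0; have Ux : x \in U by apply: stable_pact.
set z := 'X^n ** x; have z_neq0 : z != 0 by rewrite /z -pactM.
have Uz : z \in U by apply: stable_pact.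
have cycU := stable_cyclic U_stable Ux.
have z_out : z \notin (shift @: cyclic quad x)%VS.
  apply/negP=> /memv_imgP[_ /cyclicP[g ->] Dz]; case/eqP: (z_neq0).
  have gX0 : (g * 'X) ** x = 0.
    by rewrite -pact_quad -(coshift_shift u_Sp) -Dz -v_shift shXn ?linear0.
  have := pact_eq0_dvd X_irr (Xn1 _ Ux0) z_neq0 gX0.
  rewrite exprSr dvdp_mul2r ?polyX_eq0 // => /dvdpP[g' Dg].
  by rewrite Dz Dg pactM -(pact_shift u_Sp) shXn ?linear0.
have [w0 w0D bzw0] := orthov_separation b_nondeg z_out.
have [w [w1 [Dw Uw /mem_orthovP U'w1]]] := orthov_decomp b_nondeg w0 U_nondeg.
have bw t : t \in U -> b t w = b t w0.
  by move=> Ut; rewrite Dw formDr (skewC b t w1) U'w1 // oppr0 addr0.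
set y := m ** (c ** w); have Ucw : c ** w \in U by apply: stable_pact.
have Uy : y \in U by apply: stable_pact.
have cycyU := stable_cyclic U_stable Uy.
have cmz : (c * m) ** z = z.
  rewrite -[c * m](addrK (d * 'X)) cd1 pactB pact1 pactM pactX.
  by rewrite /z pact_quad -exprSr Xn1 // linear0 subr0.
have xy_neq0 : b z y != 0.
  by rewrite /y -pactM mulrC -(pact_adj u_Sp) cmz bw.
have shx_y f : b (shift (f ** x)) y = 0.
  rewrite /y -pactM -(pact_adj u_Sp) (pact_shift u_Sp) -pactM.
  have Uf : (m * c * f) ** x \in U by apply: stable_pact.
  by rewrite bw ?stable_shift // w0D // memv_img // mem_cyclic.
exists (cyclic quad x + coshift @: cyclic quad y)%VS.
exists (cyclic quad y + shift @: cyclic quad x)%VS.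
split.
- by apply: (@adapted_hyperbolic n); rewrite ?shXn.
- rewrite subv_add cycU; apply/subvP=> _ /memv_imgP[t /(subvP cycyU) Ut ->].
  exact: stable_coshift.
- rewrite subv_add cycyU; apply/subvP=> _ /memv_imgP[t /(subvP cycU) Ut ->].
  exact: stable_shift.
apply: (@mem_neq0 _ x).
  exact/(subvP (addvSl _ _))/(subvP (addvSl _ _))/cyclic_self.
by apply: contraNneq z_neq0 => x_eq0; rewrite /z x_eq0 linear0.
Qed.

(** The complement of [U] is stable, so a preimage of [(u + 1)^(2n) x] under
    [(u + 1)^(2n+1)] may be taken in [U].  There [m (u + 1)^(2n+1)] is zero, so
    [(u + 1)^(2n) x] would be killed by [m] and by [X + 4], which are coprime. *)
Lemma odd_cell_minus1 : r = quad4 -> has_jordan_cell u n.*2.+1 (-1).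
Proof.
move=> r4; move: r_irr r_ndvd mU x0_neq0 diff_eq.
rewrite r4 => r4_irr r4_nd r4U x_neq0 r4diff.
have [c [d cd1]] := bezout_irreducible r4_irr r4_nd.
have MU t : t \in U -> M ((quad4 ^+ n * m) ** t) = 0.
  move=> Ut; apply: plus1_eq0 (r4diff t Ut).
  by rewrite -pactM mulrA -exprS r4U.
apply: (@jordan_cell_of_vector _ _ u M (-1) _ _ _ (m ** x0)) => //.
- by move=> t; rewrite plus1E scaleN1r addrC addrK.
- by rewrite iterSr plus1_iter_double pact_plus1 -pactM MU // -pactXn linear0.
move=> w Dw.
have [w1 [w2 [Dw12 Uw1 U'w2]]] := orthov_decomp b_nondeg w U_nondeg.
have stableM W : stable W -> {in W, forall t, M t \in W}.
  by case=> uW _ t Wt; rewrite plus1E rpredD ?uW.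
have iterM k W t : stable W -> t \in W -> iter k M t \in W.
  by move=> W_st Wt; elim: k => //= k; apply: stableM.
have Dw1 : iter n.*2 M (m ** x0) = iter n.*2.+1 M w1.
  apply/eqP; rewrite -subr_eq0; apply/eqP/U_nondeg.
    by rewrite rpredB ?iterM ?stable_pact.
  have -> : iter n.*2 M (m ** x0) - iter n.*2.+1 M w1 = iter n.*2.+1 M w2.
    by rewrite Dw Dw12 -!pactXn linearD /= addrC addKr.
  by apply/mem_orthovP/iterM => //; apply: stable_orthov.
have t0 : m ** iter n.*2 M (m ** x0) = 0.
  rewrite Dw1 iterSr plus1_iter_double pact_iter -pactM mulrC pact_plus1 MU //.
  by rewrite -pactXn linear0.
case/eqP: x_neq0; apply: (@pact_coprime _ _ quad _ _ _ _ _ cd1); last first.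
  by rewrite -pactM mulrA -exprS r4U.
have: iter n u (m ** ((quad4 ^+ n * m) ** x0)) = 0.
  by rewrite -pact_iter [(_ * m) ** _]pactM -plus1_iter_double.
elim: {1}n => //= k IHk /(congr1 v); rewrite (Sp_invKl u_Sp) linear0.
exact: IHk.
Qed.

End LocalStep.

Lemma refinable_or_odd_cell U : stable U -> nondeg_on b U -> U != 0%VS ->
  refinable U \/ exists k, odd k /\ has_jordan_cell u k (-1).
Proof.
move=> U_st U_nd U_neq0.
have [r [n [m [r_monic r_irr r_nd mU [x0 Ux0 x0_neq0]]]]] :=
  primary_component U_neq0 (stable_quad U_st).
have [[y [Uy y_neq0]]|diffU] :=
  classic (exists y, y \in U /\ (r ^+ n * m) ** (u y - v y) != 0).
  left; exact: refinable_generic y_neq0.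
have {}diffU : {in U, forall y, (r ^+ n * m) ** (u y - v y) = 0}.
  move=> y Uy; apply/eqP; rewrite -[_ == _]negbK; apply/negP=> y_neq0.
  by case: diffU; exists y.
have := degenerate_dvd r_irr mU Ux0 x0_neq0 diffU.
case/(irreducible_dvd_quad r_monic r_irr) => Dr.
  left; exact: refinable_unipotent r_irr r_nd mU Ux0 x0_neq0 diffU Dr.
right; exists n.*2.+1; rewrite /= odd_double; split=> //.
exact: odd_cell_minus1 r_irr r_nd mU Ux0 x0_neq0 diffU Dr.
Qed.

Lemma addvACA P P1 Q Q1 : (P + P1 + (Q + Q1) = P + Q + (P1 + Q1))%VS.
Proof. by rewrite -addvA [(P1 + _)%VS]addvA [(P1 + Q)%VS]addvC !addvA. Qed.

Lemma adapted_add E P Q P1 Q1 : E = (P + Q)%VS ->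
  adapted P Q -> adapted P1 Q1 ->
  (P1 <= orthov b E)%VS -> (Q1 <= orthov b E)%VS -> adapted (P + P1) (Q + Q1).
Proof.
move=> -> [Pi Qi shP cshQ PQn] [P1i Q1i shP1 cshQ1 PQ1n] P1E Q1E.
have orth S T : (S <= P + Q)%VS -> (T <= orthov b (P + Q))%VS ->
    {in S & T, forall x y, b x y = 0}.
  move=> SE /subvP TE x y Sx /TE/mem_orthovP yE.
  by rewrite skewC yE ?oppr0 // (subvP SE).
split.
- by apply: isotropic_add => //; apply: orth; rewrite ?addvSl.
- by apply: isotropic_add => //; apply: orth; rewrite ?addvSr.
- move=> _ /memv_addP[x Px [y P1y ->]]; rewrite linearD.
  by rewrite memv_add ?shP ?shP1.
- move=> _ /memv_addP[x Qx [y Q1y ->]]; rewrite linearD.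
  by rewrite memv_add ?cshQ ?cshQ1.
rewrite addvACA; apply: nondeg_add => //.
by rewrite subv_add P1E.
Qed.

Lemma adapted_grow P Q : ~ (exists k, odd k /\ has_jordan_cell u k (-1)) ->
  adapted P Q -> (P + Q)%VS != fullv ->
  exists P' Q', adapted P' Q' /\ (\dim (P + Q) < \dim (P' + Q'))%N.
Proof.
move=> no_cell PQ_ad PQ_nfull; have [_ _ shP cshQ PQn] := PQ_ad.
set E := (P + Q)%VS in PQ_nfull PQn *.
have U_neq0 : orthov b E != 0%VS.
  apply: contraNneq PQ_nfull => U0.
  by rewrite -(orthov_split b_nondeg PQn) U0 addv0.
have U_st : stable (orthov b E) by apply/stable_orthov/stable_pair.
have U_nd : nondeg_on b (orthov b E) by apply: nondeg_orthov.
have [|//] := refinable_or_odd_cell U_st U_nd U_neq0.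
case=> P1 [Q1 [PQ1_ad P1U Q1U PQ1_neq0]].
exists (P + P1)%VS, (Q + Q1)%VS; split; first exact: (adapted_add (E := E)).
rewrite addvACA dimv_disjoint_sum -/E; last first.
  apply/eqP; rewrite -subv0; apply/subvP=> x /memv_capP[Ex PQ1x].
  rewrite memv0; apply/eqP/PQn => //; apply/mem_orthovP.
  by apply: subvP PQ1x; rewrite subv_add P1U.
by rewrite -[X in (X < _)%N]addn0 ltn_add2l lt0n dimv_eq0.
Qed.

(** The pair [(0, 0)] is adapted, and each enlargement increases the dimension
    of the sum. *)
Lemma adapted_exists : ~ (exists k, odd k /\ has_jordan_cell u k (-1)) ->
  exists P Q, adapted P Q /\ (P + Q)%VS = fullv.
Proof.
move=> no_cell.
have ad0 : adapted 0 0.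
  have iso0 : isotropic b 0.
    by move=> x y; rewrite memv0 => /eqP-> _; rewrite skewC form0r oppr0.
  split=> // [x|x|x]; last by rewrite addv0 memv0 => /eqP.
    by rewrite !memv0 => /eqP->; rewrite linear0.
  by rewrite !memv0 => /eqP->; rewrite linear0.
suffices grow n P Q : adapted P Q -> (\dim {:V} - \dim (P + Q) <= n)%N ->
    exists P' Q', adapted P' Q' /\ (P' + Q')%VS = fullv.
  exact: grow ad0 (leqnn _).
elim: n P Q => [|n IHn] P Q PQ_ad le_n.
  exists P, Q; split=> //; apply/eqP; rewrite eqEdim subvf.
  by rewrite -subn_eq0 -leqn0.
have [PQ_full|PQ_nfull] := eqVneq (P + Q)%VS fullv; first by exists P, Q.
have [P' [Q' [PQ'_ad lt_dim]]] := adapted_grow no_cell PQ_ad PQ_nfull.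
apply: IHn PQ'_ad _; have := dimvS (subvf (P' + Q')%VS); lia.
Qed.

End AdaptedPairs.

Theorem theorem1p5 (F : fieldType) (char_neq2 : 2%N \notin [pchar F])
    (V : vectType F) (b : {skew_symmetric V}) (b_nondeg : nondegenerate b)
    (u : 'End(V)) (u_Sp : in_Sp b u) :
  (prod_two_U2 (@in_GL F V) u <-> prod_two_U2 (in_Sp b) u) /\
  (prod_two_U2 (in_Sp b) u <->
     ~ (exists k : nat, odd k /\ has_jordan_cell u k (-1))).
Proof.
have two_neq0 : 2%:R != 0 :> F by apply: contra char_neq2; rewrite inE.
have Sp_GL : prod_two_U2 (in_Sp b) u -> prod_two_U2 (@in_GL F V) u.
  by case=> u1 [u2 [[? _] ? [? _] ? ?]]; exists u1, u2.
have GL_cells : prod_two_U2 (@in_GL F V) u ->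
    ~ (exists k : nat, odd k /\ has_jordan_cell u k (-1)).
  case=> u1 [u2 [_ u1_U2 _ u2_U2 u_prod]] [k [k_odd k_cell]].
  have uE x : u x = -1 *: x + plus1 u x by rewrite plus1E scaleN1r addrC addrK.
  have k_gt0 : (0 < k)%N by case: k k_odd {k_cell}.
  have [x [Mx0 x_out]] := jordan_cell_vector uE k_gt0 k_cell.
  have Dk : k.-1 = k./2.*2 by rewrite -{1}[k]odd_double_half k_odd.
  have [u_GL _] := u_Sp.
  have Dx : iter k.-1 (plus1 u) x = iter k./2.*2 (plus1 u) x by rewrite Dk.
  have [z] := plus1_kernel_image two_neq0 u_GL u1_U2 u2_U2 u_prod Dx Mx0.
  by rewrite -Dk prednK // => /x_out.
have cells_Sp : ~ (exists k : nat, odd k /\ has_jordan_cell u k (-1)) ->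
    prod_two_U2 (in_Sp b) u.
  move=> /(adapted_exists two_neq0 b_nondeg u_Sp)[P [Q [PQ_ad PQ_full]]].
  exact: adapted_prod_two_U2 PQ_ad PQ_full.
by split; split=> // ?; [apply/cells_Sp/GL_cells | apply/GL_cells/Sp_GL].
Qed.
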